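(* Let $\Omega\subseteq\mathbb H$ be an axially symmetric slice domain and let $c=(c_k)_{k\in\mathbb N}$ be a given non-decreasing sequence of real numbers with $c_0=1$. Then there exists a sequence $b=(b_k)_{k\ge 0}$ such that $$\tau\left(\mathcal{HS}_c(\Omega)\right)=\mathcal{HM}_b(\Omega).$$ More precisely: (i) $b_k=\dfrac{c_{k+2}}{(k+1)^2(k+2)^2}$ for all $k\ge 0$; (ii) for all $f\in\mathcal{HS}_c(\Omega)$, $$\|\tau(f)\|_{\mathcal{HM}_b(\Omega)}=2\sqrt{\|f\|^2_{\mathcal{HS}_c(\Omega)}-|f(0)|^2-c_1|f'(0)|^2}.$$
   Context: $\mathbb H$ denotes the quaternions, $q=x_0+x_1i+x_2j+x_3k$; $\mathbb S=\{q\in\mathbb H:q^2=-1\}$, $\mathbb C_I=\mathbb R+I\mathbb R$ for $I\in\mathbb S$. A domain $\Omega\subseteq\mathbb H$ is a slice domain if $\Omega\cap\mathbb R\ne\emptyset$ and $\Omega\cap\mathbb C_I$ is connected for all $I\in\mathbb S$; it is axially symmetric if $x+Iy\in\Omega$ implies $x+Jy\in\Omega$ for all $J\in\mathbb S$. For $k\ge 0$, $Q_k(q)=\sum_{j=0}^k T^k_j\,q^{k-j}\overline q^{\,j}$ with $T^k_j=\frac{2(k-j+1)}{(k+1)(k+2)}$. The spaces consist of functions on $\Omega$ given by converging series: $$\mathcal{HS}_c(\Omega)=\left\{\sum_{k=0}^\infty q^kf_k:\ f_k\in\mathbb H,\ \sum_{k=0}^\infty c_k|f_k|^2<\infty\right\},\qquad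 \mathcal{HM}_b(\Omega)=\left\{\sum_{k=0}^\infty Q_k\alpha_k:\ \alpha_k\in\mathbb H,\ \sum_{k=0}^\infty b_k|\alpha_k|^2<\infty\right\},$$ with $\|\sum q^kf_k\|^2_{\mathcal{HS}_c(\Omega)}=\sum c_k|f_k|^2$ and $\|\sum Q_k\alpha_k\|^2_{\mathcal{HM}_b(\Omega)}=\sum b_k|\alpha_k|^2$. For $f=\sum q^kf_k$, $f(0)=f_0$ and $f'(0)=f_1$ (the slice derivative at $0$). The Fueter mapping is $\tau=\Delta_{\mathbb R^4}=\frac{\partial^2}{\partial x_0^2}+\frac{\partial^2}{\partial x_1^2}+\frac{\partial^2}{\partial x_2^2}+\frac{\partial^2}{\partial x_3^2}$. The sequence $b$ here need not be non-decreasing nor satisfy $b_0=1$. *)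

(* Defs.v *)
From HB Require Import structures.
From mathcomp Require Import all_boot all_order all_algebra.
From mathcomp Require Import all_classical all_reals all_analysis.
From mathcomp Require Import ring.
Set Implicit Arguments.
Unset Strict Implicit.
Unset Printing Implicit Defensive.
Import Order.TTheory GRing.Theory Num.Theory.
Import numFieldNormedType.Exports.
Local Open Scope classical_set_scope.
Local Open Scope ring_scope.

(* x0 + x1 i + x2 j + x3 k is the row vector (x0, x1, x2, x3).  The normed
   module structure of ['rV[R]_4] is kept for the topology and the derivatives;
   its norm is the sup norm, so the modulus of a quaternion is [qabs] below. *)
Definition quat (R : realType) := 'rV[R]_4.
HB.instance Definition _ (R : realType) := NormedModule.on (quat R).

Section Quaternion.
Context {R : realType}.
Implicit Types p q : quat R.

Definition mkq (x0 x1 x2 x3 : R) : quat R :=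
  \row_(i < 4) nth 0 [:: x0; x1; x2; x3] i.

Definition re q : R := q ord0 (inord 0).
Definition im1 q : R := q ord0 (inord 1).
Definition im2 q : R := q ord0 (inord 2).
Definition im3 q : R := q ord0 (inord 3).

Lemma re_mkq x0 x1 x2 x3 : re (mkq x0 x1 x2 x3) = x0.
Proof. by rewrite /re mxE inordK. Qed.
Lemma im1_mkq x0 x1 x2 x3 : im1 (mkq x0 x1 x2 x3) = x1.
Proof. by rewrite /im1 mxE inordK. Qed.
Lemma im2_mkq x0 x1 x2 x3 : im2 (mkq x0 x1 x2 x3) = x2.
Proof. by rewrite /im2 mxE inordK. Qed.
Lemma im3_mkq x0 x1 x2 x3 : im3 (mkq x0 x1 x2 x3) = x3.
Proof. by rewrite /im3 mxE inordK. Qed.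
Definition mkqE := (re_mkq, im1_mkq, im2_mkq, im3_mkq).

Lemma quatP p q : re p = re q -> im1 p = im1 q -> im2 p = im2 q ->
  im3 p = im3 q -> p = q.
Proof.
move=> e0 e1 e2 e3; apply/rowP => i.
have -> : i = inord i by apply: val_inj; rewrite /= inordK.
by case: i => -[|[|[|[|//]]]].
Qed.

Lemma reD p q : re (p + q) = re p + re q. Proof. by rewrite /re mxE. Qed.
Lemma im1D p q : im1 (p + q) = im1 p + im1 q. Proof. by rewrite /im1 mxE. Qed.
Lemma im2D p q : im2 (p + q) = im2 p + im2 q. Proof. by rewrite /im2 mxE. Qed.
Lemma im3D p q : im3 (p + q) = im3 p + im3 q. Proof. by rewrite /im3 mxE. Qed.
Definition quatDE := (reD, im1D, im2D, im3D).

Definition qone : quat R := mkq 1 0 0 0.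

Definition qmul p q : quat R := mkq
  (re p * re q - im1 p * im1 q - im2 p * im2 q - im3 p * im3 q)
  (re p * im1 q + im1 p * re q + im2 p * im3 q - im3 p * im2 q)
  (re p * im2 q - im1 p * im3 q + im2 p * re q + im3 p * im1 q)
  (re p * im3 q + im1 p * im2 q - im2 p * im1 q + im3 p * re q).

Lemma qmulA : associative qmul.
Proof. by move=> p q r; apply: quatP; rewrite !mkqE; ring. Qed.
Lemma qmul1q : left_id qone qmul.
Proof. by move=> p; apply: quatP; rewrite !mkqE; ring. Qed.
Lemma qmulq1 : right_id qone qmul.
Proof. by move=> p; apply: quatP; rewrite !mkqE; ring. Qed.
Lemma qmulDl : left_distributive qmul +%R.
Proof. by move=> p q r; apply: quatP; rewrite !(mkqE, quatDE); ring. Qed.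
Lemma qmulDr : right_distributive qmul +%R.
Proof. by move=> p q r; apply: quatP; rewrite !(mkqE, quatDE); ring. Qed.
Lemma qone_neq0 : qone != 0.
Proof.
apply/eqP => /(congr1 re); rewrite re_mkq /re mxE => /eqP.
by rewrite oner_eq0.
Qed.

End Quaternion.

HB.instance Definition _ (R : realType) := GRing.Zmodule_isNzRing.Build (quat R)
  qmulA qmul1q qmulq1 qmulDl qmulDr qone_neq0.

Section Fueter.
Context {R : realType}.
Implicit Types (q I J : quat R) (Omega : set (quat R)) (a : nat -> quat R).
Implicit Types (b c : nat -> R).

Definition qconj q : quat R := mkq (re q) (- im1 q) (- im2 q) (- im3 q).

Definition qabs q : R := Num.sqrt (\sum_(i < 4) q ord0 i ^+ 2).

Definition qreal (x : R) : quat R := mkq x 0 0 0.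

Definition sphereS : set (quat R) := [set I | I ^+ 2 = -1].

Definition slice I : set (quat R) :=
  [set q | exists x y : R, q = qreal x + I * qreal y].

Definition slice_domain Omega : Prop :=
  [/\ open Omega, connected Omega, Omega `&` range qreal !=set0
    & forall I, sphereS I -> connected (Omega `&` slice I)].

Definition axially_symmetric Omega : Prop :=
  forall (x y : R) I J, sphereS I -> sphereS J ->
    Omega (qreal x + I * qreal y) -> Omega (qreal x + J * qreal y).

Definition Tcoef (k j : nat) : R :=
  2 * (k - j + 1)%N%:R / ((k + 1)%N%:R * (k + 2)%N%:R).

Definition Qpoly (k : nat) q : quat R :=
  \sum_(j < k.+1) Tcoef k j *: (q ^+ (k - j) * qconj q ^+ j).

(* The functions on Omega are the elements of [Omega -> quat R], where the set
   Omega is coerced to the corresponding subtype. *)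

(* [a] is a coefficient sequence of [f] with respect to the left basis
   functions [P k]: the series converges to [f] at every point of Omega and the
   coefficients are square summable for the weight [w]. *)
Definition series_coefs Omega (P : nat -> quat R -> quat R) (w : nat -> R)
    (f : Omega -> quat R) : set (nat -> quat R) :=
  [set a | (forall q : Omega,
              series (fun k => P k (val q) * a k) @ \oo --> f q)
         /\ cvgn (series (fun k => w k * qabs (a k) ^+ 2))].

Definition pow_basis (k : nat) q : quat R := q ^+ k.

Definition HS Omega c : set (Omega -> quat R) :=
  [set f | series_coefs pow_basis c f !=set0].

Definition HM Omega b : set (Omega -> quat R) :=
  [set g | series_coefs Qpoly b g !=set0].

(* For a slice domain the coefficients are unique, since both series restrict to
   the same ordinary power series on a nonempty open subset of the real line
   (Qpoly k x = x ^+ k for real x); [xget] therefore selects the only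
   coefficient sequence. *)
Definition HS_coef Omega c (f : Omega -> quat R) : nat -> quat R :=
  xget (fun=> 0) (series_coefs pow_basis c f).

Definition HM_coef Omega b (g : Omega -> quat R) : nat -> quat R :=
  xget (fun=> 0) (series_coefs Qpoly b g).

Definition wnorm (w : nat -> R) a : R :=
  Num.sqrt (limn (series (fun k => w k * qabs (a k) ^+ 2))).

Definition HSnorm Omega c (f : Omega -> quat R) : R := wnorm c (HS_coef c f).

Definition HMnorm Omega b (g : Omega -> quat R) : R := wnorm b (HM_coef b g).

(* Extension by 0 outside Omega; on an open Omega the partial derivatives at
   points of Omega do not depend on it. *)
Definition ext0 Omega (f : Omega -> quat R) : quat R -> quat R := valL_ (0 : quat R) f.

Definition partial (i : 'I_4) (F : quat R -> quat R) : quat R -> quat R :=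
  fun q => 'D_(delta_mx ord0 i : quat R) F q.

Definition has_partial (i : 'I_4) (F : quat R -> quat R) q : Prop :=
  derivable F q (delta_mx ord0 i : quat R).

Definition has_laplacian Omega (f : Omega -> quat R) : Prop :=
  forall (q : Omega) (i : 'I_4),
    has_partial i (ext0 f) (val q) /\ has_partial i (partial i (ext0 f)) (val q).

Definition tau Omega (f : Omega -> quat R) : Omega -> quat R :=
  fun q : Omega => \sum_(i < 4) partial i (partial i (ext0 f)) (val q).

End Fueter.

(* Main.v *)
Require Import Defs.
From HB Require Import structures.
From mathcomp Require Import all_boot all_order all_algebra.
From mathcomp Require Import all_classical all_reals all_analysis.
From mathcomp Require Import ring lra zify.
Set Implicit Arguments.
Unset Strict Implicit.
Unset Printing Implicit Defensive.
Import Order.TTheory GRing.Theory Num.Theory.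
Import numFieldNormedType.Exports.
Local Open Scope classical_set_scope.
Local Open Scope ring_scope.

(** The Laplacian can be computed termwise on power series. Differentiating
    q^k twice along each of the four units by the product rule, and using
    that e p e summed over the units e is -2 times the conjugate of p,
    gives tau(q^(k+2)) = -2 (k+1) (k+2) Q_k and tau(1) = tau(q) = 0
    ([laplacian_pow]). Hence tau maps the power series with coefficients a
    to the Q-series with coefficients alpha_k = -2 (k+1) (k+2) a_(k+2), and
    b_k |alpha_k|^2 = 4 c_(k+2) |a_(k+2)|^2 for the weight b of the theorem
    ([tau_weight_term]). Summing over k is the norm identity: the terms
    missing on the right are those of index 0 and 1.

    Three analytic facts make this rigorous.

    Termwise differentiation ([termwise_partial]): since Omega is open, a
    power series that converges at every point of Omega converges
    absolutely beyond the modulus of each point ([pow_decays]). The first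
    and second derivatives of q^k and their Taylor remainders are bounded
    by constants times s^k for any s larger than the modulus of q
    ([pow_taylor], [dpow_taylor]), which allows differentiating twice under
    the sum.

    Surjectivity: from a Q-series that converges on Omega one reads off
    a_(k+2), and, with a_0 = a_1 = 0, has to show that its power series
    converges on Omega too. The identity [qsum_telescope] shows that at a
    nonreal point q the modulus of k^2 Q_k(q) is eventually at least a
    constant times |q|^k, so the terms of the power series are bounded at
    nonreal points; every point of Omega has such a point of larger modulus
    nearby ([Qpoly_decays]).

    Uniqueness of the coefficients of a Q-series, needed because the norm
    on the target refers to them: for real x one has Q_k(x) = x^k, so two
    expansions of the same function give a power series vanishing on an
    open piece of the real axis, which may not contain 0. Its coefficients
    vanish ([pseries_coefs_eq0]): after rescaling to the unit disc, each
    zero can be divided out by a Blaschke factor without increasing the l^2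
    norm of the coefficients, and multiplies the bound on the constant term
    by its modulus, so infinitely many zeros in a compact part of the disc
    force the constant term, and then all the others, to be 0. *)

(** * The modulus of a quaternion *)

(** Completeness makes absolutely convergent series of quaternions converge. *)
HB.instance Definition _ (R : realType) := Complete.on (quat R).

Section Modulus.
Context {R : realType}.
Implicit Types (p q r : quat R) (t x : R).

Lemma big_ord4 (V : nmodType) (F : 'I_4 -> V) :
  \sum_(i < 4) F i = F (inord 0) + F (inord 1) + F (inord 2) + F (inord 3).
Proof.
rewrite !big_ord_recl big_ord0 addr0 !addrA.
by congr (_ + _ + _ + _); congr F; apply: val_inj; rewrite /= inordK.
Qed.

Lemma sqr_qabs q :
  qabs q ^+ 2 = re q ^+ 2 + im1 q ^+ 2 + im2 q ^+ 2 + im3 q ^+ 2.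
Proof.
by rewrite sqr_sqrtr ?sumr_ge0 ?big_ord4 // => i _; rewrite sqr_ge0.
Qed.

Lemma qabs_ge0 q : 0 <= qabs q. Proof. exact: sqrtr_ge0. Qed.

Lemma qabsP q x : 0 <= x ->
  re q ^+ 2 + im1 q ^+ 2 + im2 q ^+ 2 + im3 q ^+ 2 = x ^+ 2 -> qabs q = x.
Proof.
move=> x0; rewrite -sqr_qabs => /eqP; rewrite eqrXn2 ?qabs_ge0 //.
by move/eqP.
Qed.

Lemma mulqE p q : p * q = qmul p q. Proof. by []. Qed.

Lemma reN q : re (- q) = - re q. Proof. by rewrite /re mxE. Qed.
Lemma im1N q : im1 (- q) = - im1 q. Proof. by rewrite /im1 mxE. Qed.
Lemma im2N q : im2 (- q) = - im2 q. Proof. by rewrite /im2 mxE. Qed.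
Lemma im3N q : im3 (- q) = - im3 q. Proof. by rewrite /im3 mxE. Qed.
Lemma reZ t q : re (t *: q) = t * re q. Proof. by rewrite /re mxE. Qed.
Lemma im1Z t q : im1 (t *: q) = t * im1 q. Proof. by rewrite /im1 mxE. Qed.
Lemma im2Z t q : im2 (t *: q) = t * im2 q. Proof. by rewrite /im2 mxE. Qed.
Lemma im3Z t q : im3 (t *: q) = t * im3 q. Proof. by rewrite /im3 mxE. Qed.
Lemma re0 : re (0 : quat R) = 0. Proof. by rewrite /re mxE. Qed.
Lemma im10 : im1 (0 : quat R) = 0. Proof. by rewrite /im1 mxE. Qed.
Lemma im20 : im2 (0 : quat R) = 0. Proof. by rewrite /im2 mxE. Qed.
Lemma im30 : im3 (0 : quat R) = 0. Proof. by rewrite /im3 mxE. Qed.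
Lemma oneqE : 1 = mkq 1 0 0 0 :> quat R. Proof. by []. Qed.

(** With [quatP] and [ring], proves any polynomial identity between quaternions
    componentwise. *)
Definition quatE := (mulqE, oneqE, @mkqE R, @quatDE R, (reN, im1N, im2N, im3N),
  (reZ, im1Z, im2Z, im3Z), (re0, im10, im20, im30)).

Lemma qabsM p q : qabs (p * q) = qabs p * qabs q.
Proof.
apply: qabsP; first by rewrite mulr_ge0 ?qabs_ge0.
by rewrite exprMn !sqr_qabs !quatE; ring.
Qed.

Lemma qabs0 : qabs (0 : quat R) = 0.
Proof. by apply: qabsP => //; rewrite !quatE; ring. Qed.

Lemma qabs1 : qabs (1 : quat R) = 1.
Proof. by apply: qabsP => //; rewrite !quatE; ring. Qed.

Lemma qabsX q k : qabs (q ^+ k) = qabs q ^+ k.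
Proof.
by elim: k => [|k IH]; rewrite ?expr0 ?qabs1 // !exprS qabsM IH.
Qed.

Lemma qabsZ t q : qabs (t *: q) = `|t| * qabs q.
Proof.
apply: qabsP; first by rewrite mulr_ge0 ?qabs_ge0.
by rewrite exprMn real_normK ?num_real // sqr_qabs !quatE; ring.
Qed.

Lemma qabsN q : qabs (- q) = qabs q.
Proof. by apply: qabsP; rewrite ?qabs_ge0 // sqr_qabs !quatE; ring. Qed.

Lemma qabs_conj q : qabs (qconj q) = qabs q.
Proof. by apply: qabsP; rewrite ?qabs_ge0 // sqr_qabs !quatE; ring. Qed.

Lemma qabs_real x : qabs (qreal x) = `|x|.
Proof.
by apply: qabsP => //; rewrite real_normK ?num_real // !quatE; ring.
Qed.

(** Cauchy-Schwarz through the four squares identity: |p|^2 |q|^2 minus the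
    square of the inner product is the sum of the squares of the imaginary
    components of p times the conjugate of q. *)
Lemma ler_qabsD p q : qabs (p + q) <= qabs p + qabs q.
Proof.
pose ip := re p * re q + im1 p * im1 q + im2 p * im2 q + im3 p * im3 q.
have ip_le : ip <= qabs p * qabs q.
  apply: le_trans (ler_norm _) _.
  rewrite -ler_sqr ?nnegrE ?mulr_ge0 ?qabs_ge0 // real_normK ?num_real //.
  rewrite -subr_ge0; set d := _ - _.
  have -> : d = im1 (p * qconj q) ^+ 2 + im2 (p * qconj q) ^+ 2
                + im3 (p * qconj q) ^+ 2.
    by rewrite /d /ip exprMn !sqr_qabs !quatE; ring.
  by rewrite !addr_ge0 ?sqr_ge0.
rewrite -ler_sqr ?nnegrE ?addr_ge0 ?qabs_ge0 //.
rewrite sqrrD !sqr_qabs !quatE -subr_ge0; set d := _ - _.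
have -> : d = (qabs p * qabs q - ip) *+ 2 by rewrite /d /ip; ring.
by rewrite mulrn_wge0 // subr_ge0.
Qed.

Lemma ler_qabsB p q : qabs p - qabs q <= qabs (p + q).
Proof.
rewrite lerBlDr -[X in qabs X <= _](addrK q p).
by rewrite (le_trans (ler_qabsD _ _)) // qabsN.
Qed.

Lemma normqE q : `|q| = \big[Num.max/0]_ij `|q ij.1 ij.2|.
Proof. exact: mx_normrE. Qed.

(** The topology comes from the sup norm and the estimates are for the
    multiplicative modulus; this and the next two bounds compare the two. *)
Lemma coord_le_qabs q j : `|q ord0 j| <= qabs q.
Proof.
rewrite -ler_sqr ?nnegrE ?qabs_ge0 // real_normK ?num_real //.
rewrite /qabs sqr_sqrtr; last by rewrite sumr_ge0 // => k _; rewrite sqr_ge0.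
by rewrite (bigD1 j) //= lerDl sumr_ge0 // => k _; rewrite sqr_ge0.
Qed.

Lemma normr_le_qabs q : `|q| <= qabs q.
Proof.
rewrite normqE; apply/bigmax_leP; split=> [|[i j] _ /=]; first exact: qabs_ge0.
by rewrite ord1 coord_le_qabs.
Qed.

Lemma qabs_le_normr q : qabs q <= 2 * `|q|.
Proof.
rewrite -ler_sqr ?nnegrE ?qabs_ge0 ?mulr_ge0 //.
rewrite /qabs sqr_sqrtr; last by rewrite sumr_ge0 // => k _; rewrite sqr_ge0.
apply: (@le_trans _ _ (\sum_(i < 4) `|q| ^+ 2)).
  apply: ler_sum => i _; rewrite -[leLHS]real_normK ?num_real //.
  rewrite ler_sqr ?nnegrE // normqE.
  by apply/bigmax_geP; right => /=; exists (ord0, i).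
by rewrite big_ord4 exprMn; lra.
Qed.

Lemma scaleqAl t p q : (t *: p) * q = t *: (p * q).
Proof. by apply: quatP; rewrite !quatE; ring. Qed.

Lemma scaleqAr t p q : p * (t *: q) = t *: (p * q).
Proof. by apply: quatP; rewrite !quatE; ring. Qed.

Lemma qabs_delta (i : 'I_4) : qabs (delta_mx ord0 i : quat R) = 1.
Proof.
rewrite /qabs (bigD1 i) //= big1 => [|j ji].
  by rewrite mxE !eqxx expr1n addr0 sqrtr1.
by rewrite mxE (negbTE ji) andbF expr0n.
Qed.

End Modulus.

(** * Directional derivatives of the powers *)

Section PowerDerivatives.
Context {R : realType}.
Implicit Types (p q e : quat R) (t eta s : R).

(** [dpow e k] and [ddpow e k] are the first and second derivatives of the k-th
    power along e, obtained from q^(k+1) = q q^k by the product rule. *)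
Fixpoint dpow e k q : quat R :=
  if k is j.+1 then e * q ^+ j + q * dpow e j q else 0.

Fixpoint ddpow e k q : quat R :=
  if k is j.+1 then (e * dpow e j q) *+ 2 + q * ddpow e j q else 0.

Section Bounds.
Variables (e q : quat R) (eta : R).
Hypotheses (e1 : qabs e = 1) (eta0 : 0 < eta).
(** As with Cauchy's estimates, giving up a margin in the radius replaces the
    polynomial factors in k by negative powers of eta. The margin is twice eta
    because the point itself may move by eta. *)
Let s := qabs q + eta *+ 2.

Let s_ge0 : 0 <= s.
Proof. by rewrite /s addr_ge0 ?qabs_ge0 // mulrn_wge0 ?ltW. Qed.

Let sX_ge0 k : 0 <= s ^+ k. Proof. exact: exprn_ge0. Qed.

Let qabs_shift t : `|t| <= eta -> qabs (q + t *: e) <= qabs q + eta.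
Proof.
by move=> te; rewrite (le_trans (ler_qabsD _ _)) // qabsZ e1 mulr1 lerD2l.
Qed.

Let pow_bound p k : qabs p <= qabs q + eta -> qabs (p ^+ k) <= s ^+ k.
Proof.
move=> ps; rewrite qabsX lerXn2r ?nnegrE ?qabs_ge0 //.
by rewrite (le_trans ps) // /s mulr2n addrA lerDl ltW.
Qed.

(** All the estimates below are for linear recursions x_{k+1} = y_k + p x_k; if
    the source y_k is at most eta X, a bound X on x_k gets multiplied by s. *)
Let rec_bound p x y (X : R) : qabs p <= qabs q + eta ->
  qabs x <= X -> qabs y <= eta * X -> qabs (y + p * x) <= s * X.
Proof.
move=> pq xX yX; rewrite (le_trans (ler_qabsD _ _)) // qabsM.
have px : qabs p * qabs x <= (qabs q + eta) * X by rewrite ler_pM ?qabs_ge0.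
rewrite /s; lra.
Qed.

Lemma dpow_bound p k : qabs p <= qabs q + eta ->
  qabs (dpow e k p) <= eta^-1 * s ^+ k.
Proof.
move=> pq; elim: k => [|k IH] /=.
  by rewrite qabs0 mulr_ge0 // invr_ge0 ltW.
rewrite [_ ^+ k.+1]exprS [leRHS]mulrCA; apply: rec_bound => //.
by rewrite qabsM e1 mul1r mulVKf ?gt_eqF // pow_bound.
Qed.

Lemma ddpow_bound k : qabs (ddpow e k q) <= 2 * eta ^- 2 * s ^+ k.
Proof.
have qq : qabs q <= qabs q + eta by rewrite lerDl ltW.
elim: k => [|k IH] /=.
  by rewrite qabs0 !mulr_ge0 // invr_ge0 exprn_ge0 // ltW.
rewrite [_ ^+ k.+1]exprS [leRHS]mulrCA; apply: rec_bound => //.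
rewrite -scaler_nat qabsZ qabsM e1 mul1r ger0_norm //.
rewrite [leRHS](_ : _ = 2 * (eta^-1 * s ^+ k)).
  by rewrite ler_pM2l // dpow_bound.
by field; rewrite gt_eqF.
Qed.

Section Increment.
Variable t : R.
Hypothesis t_small : `|t| <= eta.
Let q' := q + t *: e.
Let q'_le : qabs q' <= qabs q + eta := qabs_shift t_small.
Let qq : qabs q <= qabs q + eta.
Proof. by rewrite lerDl ltW. Qed.

Let pow_diff k : qabs (q' ^+ k - q ^+ k) <= `|t| * eta^-1 * s ^+ k.
Proof.
elim: k => [|k IH] /=.
  by rewrite subrr qabs0 !mulr_ge0 // invr_ge0 ltW.
rewrite ![_ ^+ k.+1]exprS [leRHS]mulrCA.
have -> : q' * q' ^+ k - q * q ^+ k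
    = t *: (e * q' ^+ k) + q * (q' ^+ k - q ^+ k).
  rewrite {1}/q' mulrDl scaleqAl mulrBr.
  move: (q * _) (q * _) (t *: _) => x y z.
  by apply/rowP => i; rewrite !mxE; ring.
apply: rec_bound => //; rewrite qabsZ qabsM e1 mul1r.
rewrite [leRHS](_ : _ = `|t| * s ^+ k); last by field; rewrite gt_eqF.
by rewrite ler_wpM2l // pow_bound.
Qed.

Lemma pow_taylor k : qabs (q' ^+ k - q ^+ k - t *: dpow e k q)
  <= t ^+ 2 * eta ^- 2 * s ^+ k.
Proof.
elim: k => [|k IH] /=.
  rewrite subrr scaler0 subr0 qabs0.
  by rewrite (mulr_ge0 (mulr_ge0 _ _)) ?invr_ge0 ?sqr_ge0.
rewrite ![_ ^+ k.+1]exprS [leRHS]mulrCA.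
have -> : q' * q' ^+ k - q * q ^+ k - t *: (e * q ^+ k + q * dpow e k q)
    = t *: (e * (q' ^+ k - q ^+ k)) + q * (q' ^+ k - q ^+ k - t *: dpow e k q).
  rewrite {1}/q' mulrDl scaleqAl !mulrBr scalerBr scalerDr scaleqAr.
  move: (q * q' ^+ k) (q * q ^+ k) (t *: _) (t *: _) (t *: _) => x y z u v.
  by apply/rowP => i; rewrite !mxE; ring.
apply: rec_bound => //; rewrite qabsZ qabsM e1 mul1r.
rewrite [leRHS](_ : _ = `|t| * (`|t| * eta^-1 * s ^+ k)).
  by rewrite ler_wpM2l ?pow_diff.
by rewrite -[t ^+ 2]real_normK ?num_real //; field; rewrite gt_eqF.
Qed.

Let dpow_diff k :
  qabs (dpow e k q' - dpow e k q) <= 2 * `|t| * eta ^- 2 * s ^+ k.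
Proof.
elim: k => [|k IH] /=.
  by rewrite subrr qabs0 !mulr_ge0 // invr_ge0 sqr_ge0.
rewrite [_ ^+ k.+1]exprS [leRHS]mulrCA.
have -> : e * q' ^+ k + q' * dpow e k q' - (e * q ^+ k + q * dpow e k q)
    = e * (q' ^+ k - q ^+ k) + t *: (e * dpow e k q')
      + q * (dpow e k q' - dpow e k q).
  rewrite {2}/q' mulrDl scaleqAl !mulrBr.
  move: (e * _) (e * _) (q * _) (q * _) (t *: _) => x y z u v.
  by apply/rowP => i; rewrite !mxE; ring.
apply: rec_bound => //; rewrite (le_trans (ler_qabsD _ _)) //.
rewrite qabsZ !qabsM e1 !mul1r.
rewrite [leRHS](_ : _ = `|t| * eta^-1 * s ^+ k + `|t| * (eta^-1 * s ^+ k)).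
  by rewrite lerD ?pow_diff // ler_wpM2l // dpow_bound.
by field; rewrite gt_eqF.
Qed.

Lemma dpow_taylor k : qabs (dpow e k q' - dpow e k q - t *: ddpow e k q)
  <= 3 * t ^+ 2 * eta ^- 3 * s ^+ k.
Proof.
elim: k => [|k IH] /=.
  rewrite subrr scaler0 subr0 qabs0.
  rewrite (mulr_ge0 (mulr_ge0 (mulr_ge0 _ _) _)) ?sqr_ge0 //.
  by rewrite invr_ge0 exprn_ge0 // ltW.
rewrite [_ ^+ k.+1]exprS [leRHS]mulrCA.
have -> : e * q' ^+ k + q' * dpow e k q' - (e * q ^+ k + q * dpow e k q)
      - t *: ((e * dpow e k q) *+ 2 + q * ddpow e k q)
    = e * (q' ^+ k - q ^+ k - t *: dpow e k q)
      + t *: (e * (dpow e k q' - dpow e k q))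
      + q * (dpow e k q' - dpow e k q - t *: ddpow e k q).
  rewrite {2}/q' mulrDl scaleqAl !mulrBr mulr2n !scalerDr !scalerN !scaleqAr.
  move: (e * q' ^+ k) (e * q ^+ k) (q * dpow e k q') (q * dpow e k q).
  move: (t *: (e * dpow e k q')) (q * ddpow e k q) (e * dpow e k q).
  move=> x1 x2 x3 x4 x5 x6 x7.
  by apply/rowP => i; rewrite !mxE; ring.
apply: rec_bound => //; rewrite (le_trans (ler_qabsD _ _)) //.
rewrite qabsZ !qabsM e1 !mul1r.
rewrite [leRHS](_ : _ = t ^+ 2 * eta ^- 2 * s ^+ k
  + `|t| * (2 * `|t| * eta ^- 2 * s ^+ k)).
  by rewrite lerD ?pow_taylor // ler_wpM2l ?dpow_diff.
by rewrite -[t ^+ 2]real_normK ?num_real //; field; rewrite gt_eqF.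
Qed.

End Increment.
End Bounds.

End PowerDerivatives.

(** * The Laplacian of a power *)

Section LaplacianOfPowers.
Context {R : realType}.
Implicit Types (p q : quat R).

Definition qunit (i : 'I_4) : quat R := delta_mx ord0 i.

Lemma qunitE : (qunit (inord 0) = mkq 1 0 0 0) * (qunit (inord 1) = mkq 0 1 0 0)
  * (qunit (inord 2) = mkq 0 0 1 0) * (qunit (inord 3) = mkq 0 0 0 1).
Proof.
by do !split; apply: quatP; rewrite mkqE /re /im1 /im2 /im3 /qunit !mxE
  -!val_eqE /= ?inordK.
Qed.

(** Summing over the four units turns a quaternion into its conjugate: this is
    where the conjugates in [Qpoly] come from. *)
Lemma sandwich_sum p : \sum_i qunit i * p * qunit i = - (2 : R) *: qconj p.
Proof. by rewrite big_ord4 !qunitE; apply: quatP; rewrite !quatE; ring. Qed.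

Lemma qconjM p q : qconj (p * q) = qconj q * qconj p.
Proof. by apply: quatP; rewrite !quatE; ring. Qed.

Lemma qconjX q k : qconj (q ^+ k) = qconj q ^+ k.
Proof.
elim: k => [|k IH]; first by apply: quatP; rewrite !quatE ?oppr0.
by rewrite exprSr qconjM IH exprS.
Qed.

Lemma comm_qconj q : GRing.comm q (qconj q).
Proof. by apply: quatP; rewrite !quatE; ring. Qed.

Definition hsum k q : quat R := \sum_(j < k.+1) q ^+ (k - j) * qconj q ^+ j.

(** [Qpoly] without its normalizing factor: the weights are integers, so that
    [qsum] satisfies a recursion in k. *)
Definition qsum k q : quat R :=
  \sum_(j < k.+1) (k - j + 1)%N%:R *: (q ^+ (k - j) * qconj q ^+ j).

Lemma Qpoly_qsum k q :
  Qpoly k q = (2 / ((k + 1)%N%:R * (k + 2)%N%:R)) *: qsum k q.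
Proof.
rewrite /Qpoly /qsum scaler_sumr; apply: eq_bigr => j _.
by rewrite scalerA /Tcoef; congr (_ *: _); rewrite mulrAC.
Qed.

Lemma hsum_recl k q : hsum k.+1 q = q ^+ k.+1 + qconj q * hsum k q.
Proof.
rewrite /hsum big_ord_recl /= subn0 expr0 mulr1 mulr_sumr; congr (_ + _).
apply: eq_bigr => j _; rewrite /bump /= add1n subSS exprS mulrA.
by rewrite -(commrX (k - j) (commr_sym (comm_qconj q))) mulrA.
Qed.

Lemma qsum_rec k q : qsum k.+1 q = q * qsum k q + hsum k.+1 q.
Proof.
rewrite /qsum /hsum big_ord_recr [X in _ = _ + X]big_ord_recr /=.
rewrite subnn add0n scale1r addrA; congr (_ + _).
rewrite mulr_sumr -big_split /=; apply: eq_bigr => j _.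
rewrite scaleqAr mulrA -exprS.
have kj : (k.+1 - j = (k - j).+1)%N by have := ltn_ord j; lia.
by rewrite kj -addn1 natrD scalerDl scale1r addn1.
Qed.

Lemma hsum_telescope k q :
  (q - qconj q) * hsum k q = q ^+ k.+1 - qconj q ^+ k.+1.
Proof. by rewrite subrXX_comm //; exact: comm_qconj. Qed.

(** One factor q - conj q telescopes the weighted sum into (k+2) q^(k+1)
    minus an unweighted one, which the second factor telescopes. For
    nonreal q the term (k+2) q^(k+1) dominates: see [qsum_lower_bound]. *)
Lemma qsum_telescope k q : (q - qconj q) ^+ 2 * qsum k q =
  (k + 2)%N%:R *: (q ^+ k.+1 * (q - qconj q)) - q ^+ k.+2 + qconj q ^+ k.+2.
Proof.
have [d dE] : exists d, d = q - qconj q by exists (q - qconj q).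
have cqd : GRing.comm q d.
  by rewrite dE; apply: commrB => //; exact: comm_qconj.
rewrite -dE; elim: k => [|k IH].
  rewrite /qsum big_ord1 /= !expr0 !mulr1 scale1r mulr1 dE.
  by apply: quatP; rewrite ?exprS ?expr0 !quatE; ring.
have tele := hsum_telescope k.+1 q; rewrite -dE in tele.
rewrite qsum_rec mulrDr mulrA -(commrX 2 cqd) -mulrA IH.
rewrite [d ^+ 2]expr2 -[d * d * _]mulrA tele.
rewrite !mulrDr !mulrN scaleqAr mulrA -(exprS q k.+1) -(exprS q k.+2).
have -> : d * q ^+ k.+2 = q ^+ k.+2 * d by apply/commrX/commr_sym.
have -> : d * qconj q ^+ k.+2 = q * qconj q ^+ k.+2 - qconj q ^+ k.+3.
  by rewrite dE mulrBl -exprS.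
rewrite addSn -[(k + 2).+1]addn1 (natrD _ (k + 2) 1) scalerDl scale1r.
move: (_ *: _) => x; move: (q ^+ k.+2 * d) (q ^+ k.+3) => y z.
move: (q * _) (qconj q ^+ k.+3) => u v.
by apply/rowP => i; rewrite !mxE; ring.
Qed.

(** The power of q on the left is there for the induction: the product rule
    moves one factor q of the power being differentiated to it. *)
Lemma sum_qunit_dpow m k q :
  \sum_i qunit i * (q ^+ m * dpow (qunit i) k.+1 q)
  = - (2 : R) *: (qconj q ^+ m * hsum k q).
Proof.
elim: k m => [|k IH] m.
  rewrite /hsum big_ord1 /= !expr0 !mulr1.
  under eq_bigr do rewrite mulr1 mulr0 addr0 mulrA.
  by rewrite sandwich_sum qconjX.
have rec i : qunit i * (q ^+ m * dpow (qunit i) k.+2 q)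
    = qunit i * q ^+ m * qunit i * q ^+ k.+1
      + qunit i * (q ^+ m.+1 * dpow (qunit i) k.+1 q).
  have -> : dpow (qunit i) k.+2 q
    = qunit i * q ^+ k.+1 + q * dpow (qunit i) k.+1 q by [].
  by rewrite 2!mulrDr [q ^+ m.+1]exprSr !mulrA.
under eq_bigr do rewrite rec.
rewrite big_split /= -mulr_suml sandwich_sum IH qconjX hsum_recl.
by rewrite scaleqAl -scalerDr mulrDr [qconj q ^+ m.+1]exprSr -mulrA.
Qed.

(** By the product rule the Laplacian L_k of q^k satisfies L_(k+2) =
    2 sum_i e_i D_i(q^(k+1)) + q L_(k+1), and the first term is given by
    [sum_qunit_dpow]; [qsum] obeys the same recursion. *)
Lemma laplacian_pow k q :
  \sum_i ddpow (qunit i) k.+2 q = - (4 : R) *: qsum k q.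
Proof.
have step j : \sum_i ddpow (qunit i) j.+2 q
    = - (4 : R) *: hsum j q + q * \sum_i ddpow (qunit i) j.+1 q.
  have rec i : ddpow (qunit i) j.+2 q
    = (qunit i * dpow (qunit i) j.+1 q) *+ 2 + q * ddpow (qunit i) j.+1 q by [].
  under eq_bigr do rewrite rec.
  rewrite big_split /= -mulr_sumr sumrMnl; congr (_ + _).
  have := sum_qunit_dpow 0 j q; rewrite !expr0 mul1r.
  under eq_bigr do rewrite mul1r.
  by move=> ->; rewrite -scaler_nat scalerA; congr (_ *: _); ring.
elim: k => [|k IH]; rewrite step.
  rewrite big1 => [|i _]; last by rewrite /= !mulr0 mul0rn addr0.
  by rewrite mulr0 addr0 /hsum /qsum !big_ord1 subnn scale1r.
by rewrite IH qsum_rec scaleqAr scalerDr addrC.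
Qed.

End LaplacianOfPowers.

(** * A real power series with infinitely many zeros vanishes *)

Section ZerosOfPowerSeries.
Context {R : realType}.
Implicit Types (h : nat -> R) (x y m M : R).

Lemma geometric_sum_le (K r : R) n : 0 <= K -> 0 <= r < 1 ->
  \sum_(k < n) K * r ^+ k <= K / (1 - r).
Proof.
move=> K0 /andP[r0 r1]; have r1' : 0 < 1 - r by rewrite subr_gt0.
rewrite -mulr_sumr ler_wpM2l // -[leRHS]mul1r ler_pdivlMr //.
have <- : 1 - r ^+ n = (\sum_(j < n) r ^+ j) * (1 - r).
  by rewrite -[LHS]opprB subrX1 -mulNr opprB mulrC.
by rewrite gerBl exprn_ge0.
Qed.

Lemma cvg_scale0 (a : R) (f : nat -> R) :
  f @ \oo --> (0 : R) -> a * f n @[n --> \oo] --> (0 : R).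
Proof. by move=> f0; rewrite -(mulr0 a); apply: cvgMr. Qed.

(** Cauchy-Schwarz against the geometric sequence of ratio x. *)
Lemma sqr_pseries_le h x n :
  (1 - x ^+ 2) * (\sum_(j < n) h j * x ^+ j) ^+ 2 <= \sum_(j < n) h j ^+ 2.
Proof.
elim: n h => [|n IH] h; first by rewrite !big_ord0 expr0n /= mulr0.
rewrite !big_ord_recl /= expr0 mulr1.
have -> : \sum_(i < n) h (lift ord0 i) * x ^+ bump 0 i
    = x * \sum_(i < n) h i.+1 * x ^+ i.
  rewrite mulr_sumr; apply: eq_bigr => i _.
  by rewrite /= /bump /= add1n exprS; ring.
rewrite [X in _ <= _ + X](_ : _ = \sum_(i < n) h i.+1 ^+ 2) //.
have := IH (fun i => h i.+1).
move: (\sum_(i < n) h i.+1 * _) (\sum_(i < n) h i.+1 ^+ 2) => s t st.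
have := sqr_ge0 (x * h 0%N - (1 - x ^+ 2) * s).
have := sqr_ge0 s; nra.
Qed.

(** The coefficients of the quotient by X - x of a power series h vanishing
    at x, solved from h_0 = - x u_0 and h_(n+1) = u_n - x u_(n+1). *)
Definition root_quot h x n : R := - (\sum_(k < n.+1) h k * x ^+ k) / x ^+ n.+1.

(** Multiplying back by 1 - x X gives the quotient of h by the Blaschke factor
    (X - x) / (1 - x X). *)
Definition blaschke_quot h x n : R :=
  root_quot h x n - (if n is k.+1 then x * root_quot h x k else 0).

Lemma root_quot0 h x : x != 0 -> h 0%N = - x * root_quot h x 0.
Proof. by move=> x0; rewrite /root_quot big_ord1 /= expr0; field. Qed.

Lemma root_quotS h x n : x != 0 ->
  h n.+1 = root_quot h x n - x * root_quot h x n.+1.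
Proof.
move=> x0; rewrite /root_quot [\sum_(k < n.+2) _]big_ord_recr /=.
rewrite ![x ^+ _.+1]exprS.
by field; rewrite expf_neq0 ?x0.
Qed.

(** Dividing by a Blaschke factor is an isometry of l^2; on truncated sums it
    leaves a boundary term. *)
Lemma sum_sqr_blaschke h x n : x != 0 ->
  \sum_(k < n.+1) blaschke_quot h x k ^+ 2
  = \sum_(k < n.+1) h k ^+ 2 + (1 - x ^+ 2) * root_quot h x n ^+ 2.
Proof.
move=> x0; elim: n => [|n IH].
  by rewrite !big_ord1 /blaschke_quot /= (root_quot0 h x0); ring.
rewrite big_ord_recr [in RHS]big_ord_recr /= IH (root_quotS h n x0).
by rewrite /blaschke_quot; ring.
Qed.

Lemma series_blaschke h x y n : x != 0 ->
  (y - x) * series (fun k => blaschke_quot h x k * y ^+ k) n.+1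
  = (1 - x * y) * series (fun k => h k * y ^+ k) n.+1
    + (1 - x ^+ 2) * (root_quot h x n * y ^+ n.+1).
Proof.
move=> x0; rewrite !seriesEord /=; elim: n => [|n IH].
  by rewrite !big_ord1 /blaschke_quot /= (root_quot0 h x0); ring.
rewrite big_ord_recr [in RHS]big_ord_recr /= mulrDr IH (root_quotS h n x0).
by rewrite /blaschke_quot !exprS; ring.
Qed.

Section OneRoot.
Variables (h : nat -> R) (x M : R).
Hypothesis x0 : x != 0.
Hypothesis hM : forall n, \sum_(k < n) h k ^+ 2 <= M.
Hypothesis hx : series (fun k => h k * x ^+ k) @ \oo --> (0 : R).

(** As x is a root, u_n is also the tail sum of h_(n+1+j) x^j, so the boundary
    term is at most the part of the l^2 norm of h beyond n. *)
Lemma root_quot_bound n :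
  \sum_(k < n.+1) h k ^+ 2 + (1 - x ^+ 2) * root_quot h x n ^+ 2 <= M.
Proof.
pose S := series (fun k => h k * x ^+ k).
(* The truncated tails, which [sqr_pseries_le] bounds. *)
pose v N := (S N - S n.+1) / x ^+ n.+1.
have vlim : v @ \oo --> root_quot h x n.
  have -> : root_quot h x n = (0 - S n.+1) / x ^+ n.+1.
    by rewrite /root_quot sub0r /S seriesEord /=.
  by apply: cvgMl; apply: cvgB => //; exact: cvg_cst.
have lim : \sum_(k < n.+1) h k ^+ 2 + (1 - x ^+ 2) * v N ^+ 2 @[N --> \oo]
    --> \sum_(k < n.+1) h k ^+ 2 + (1 - x ^+ 2) * root_quot h x n ^+ 2.
  apply: cvgD; first exact: cvg_cst.
  by apply: cvgMr; under eq_fun do rewrite expr2; rewrite expr2; apply: cvgM.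
rewrite -(cvg_lim _ lim) //; apply: limr_le.
  by apply/cvg_ex; eexists; exact: lim.
exists n.+1 => // N /= nN.
rewrite -(subnKC nN); move: (N - n.+1)%N => j.
have -> : v (n.+1 + j)%N = \sum_(i < j) h (n.+1 + i)%N * x ^+ i.
  rewrite /v /S !seriesEord /= big_split_ord /= addrAC subrr add0r mulr_suml.
  apply: eq_bigr => i _; rewrite exprD; field; exact: expf_neq0.
apply: le_trans (hM (n.+1 + j)); rewrite big_split_ord /= lerD2l.
exact: (sqr_pseries_le (fun i => h (n.+1 + i)%N) x j).
Qed.

Lemma blaschke_quot_bound n : \sum_(k < n) blaschke_quot h x k ^+ 2 <= M.
Proof.
case: n => [|n]; last by rewrite sum_sqr_blaschke ?root_quot_bound.
by rewrite big_ord0; have := hM 0; rewrite big_ord0.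
Qed.

Lemma blaschke_quot_root y : `|x| < 1 -> `|y| < 1 -> y != x ->
  series (fun k => h k * y ^+ k) @ \oo --> (0 : R) ->
  series (fun k => blaschke_quot h x k * y ^+ k) @ \oo --> (0 : R).
Proof.
move=> x1 y1 yx hy.
have qy : root_quot h x n * y ^+ n.+1 @[n --> \oo] --> (0 : R).
  have Xy : y ^+ n.+1 @[n --> \oo] --> (0 : R).
    by rewrite (cvg_shiftS (fun n => y ^+ n)); exact: cvg_expr.
  pose K := 1 + M / (1 - x ^+ 2).
  have qK n : `|root_quot h x n| <= K.
    have pos : 0 < 1 - x ^+ 2.
      by rewrite subr_gt0 -real_normK ?num_real // expr_lt1.
    have q2 : root_quot h x n ^+ 2 <= M / (1 - x ^+ 2).
      rewrite ler_pdivlMr // mulrC; apply: le_trans (root_quot_bound n).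
      by rewrite lerDr sumr_ge0 // => i _; rewrite sqr_ge0.
    rewrite -[root_quot h x n ^+ 2]real_normK ?num_real // in q2.
    by rewrite /K; have := sqr_ge0 (`|root_quot h x n| - 1); nra.
  apply/cvgr0Pnorm_lt => e e0.
  have K0 : 0 < K + 1 by have := le_trans (normr_ge0 _) (qK 0%N); lra.
  move/cvgr0Pnorm_lt : Xy => /(_ (e / (K + 1)) (divr_gt0 e0 K0)).
  apply: filterS => n; rewrite ltr_pdivlMr // normrM => yn.
  apply: le_lt_trans yn; rewrite mulrC ler_wpM2l //.
  by rewrite (le_trans (qK n)) // lerDl.
rewrite -cvg_shiftS.
have -> : (fun n => series (fun k => blaschke_quot h x k * y ^+ k) n.+1)
  = (fun n => (y - x)^-1 * ((1 - x * y) * series (fun k => h k * y ^+ k) n.+1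
      + (1 - x ^+ 2) * (root_quot h x n * y ^+ n.+1))).
  apply/funext => n; rewrite -series_blaschke // mulrA mulVf ?mul1r //.
  by rewrite subr_eq0.
apply: cvg_scale0; rewrite -[X in _ --> X](addr0 0); apply: cvgD.
  by apply: cvg_scale0; rewrite (cvg_shiftS (series _)).
exact: cvg_scale0.
Qed.

End OneRoot.

(** Each zero x_i contributes a factor |x_i| <= m: h_0 = - x_i g_0 for the
    quotient g by the Blaschke factor, whose norm is no larger and which keeps
    the remaining zeros. *)
Lemma coef0_bound n m M h (x : nat -> R) : m < 1 ->
  (forall i, x i != 0) -> (forall i, `|x i| <= m) -> injective x ->
  (forall n, \sum_(k < n) h k ^+ 2 <= M) ->
  (forall i, series (fun k => h k * x i ^+ k) @ \oo --> (0 : R)) ->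
  h 0%N ^+ 2 <= (m ^+ 2) ^+ n * M.
Proof.
move=> m1; elim: n h x => [|n IH] h x x0 xm xinj hM hx.
  by rewrite expr0 mul1r; have := hM 1%N; rewrite big_ord1.
have x1 i : `|x i| < 1 := le_lt_trans (xm i) m1.
have := IH (blaschke_quot h (x 0%N)) (fun i => x i.+1).
move=> /(_ (fun i => x0 i.+1) (fun i => xm i.+1)).
move=> /(_ (fun i j xij => succn_inj (xinj _ _ xij))).
move=> /(_ (blaschke_quot_bound (x0 0%N) hM (hx 0%N))) g0.
rewrite (root_quot0 h (x0 0%N)) exprMn sqrrN [_ ^+ n.+1]exprS -mulrA.
have <- : blaschke_quot h (x 0%N) 0 = root_quot h (x 0%N) 0.
  by rewrite /blaschke_quot subr0.
rewrite ler_pM ?sqr_ge0 //.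
  rewrite -[x 0%N ^+ 2]real_normK ?num_real // lerXn2r ?nnegrE //.
  exact: le_trans (normr_ge0 _) (xm 0%N).
apply: g0 => i; apply: blaschke_quot_root (x0 0%N) hM _ _ _ _ _ _ => //.
by apply/eqP => /xinj.
Qed.

(** The constant term vanishes by [coef0_bound]; dividing by X keeps the nonzero
    zeros, so the same holds for the other coefficients. *)
Lemma l2_coefs_eq0 m M h (x : nat -> R) : m < 1 ->
  (forall i, x i != 0) -> (forall i, `|x i| <= m) -> injective x ->
  (forall n, \sum_(k < n) h k ^+ 2 <= M) ->
  (forall i, series (fun k => h k * x i ^+ k) @ \oo --> (0 : R)) ->
  forall k, h k = 0.
Proof.
move=> m1 x0 xm xinj hM hx k.
have m0 : 0 <= m := le_trans (normr_ge0 _) (xm 0%N).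
have coef0 (g : nat -> R) : (forall n, \sum_(k < n) g k ^+ 2 <= M) ->
    (forall i, series (fun k => g k * x i ^+ k) @ \oo --> (0 : R)) -> g 0%N = 0.
  move=> gM gx; apply/eqP; rewrite -sqrf_eq0 -(rwP eqP); apply/le_anti.
  rewrite sqr_ge0 andbT.
  have lim : (m ^+ 2) ^+ n * M @[n --> \oo] --> (0 : R).
    rewrite -(mul0r M); apply: cvgMl; apply: cvg_expr.
    by rewrite ger0_norm ?sqr_ge0 // expr_lt1.
  rewrite -(cvg_lim _ lim) //; apply: limr_ge.
    by apply/cvg_ex; eexists; exact: lim.
  by apply: nearW => n; exact: coef0_bound m1 x0 xm xinj gM gx.
elim: k h hM hx => [|k IH] h hM hx; first exact: coef0.
apply: (IH (fun k => h k.+1)) => [n|i].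
  apply: le_trans (hM n.+1); rewrite big_ord_recl lerDr; exact: sqr_ge0.
have h0 := coef0 h hM hx.
have -> : series (fun k => h k.+1 * x i ^+ k)
  = (fun n => (x i)^-1 * series (fun k => h k * x i ^+ k) n.+1).
  apply/funext => n; rewrite !seriesEord /= big_ord_recl /= h0 mul0r add0r.
  rewrite mulr_sumr; apply: eq_bigr => j _; rewrite /bump add1n exprS.
  by field.
by apply: cvg_scale0; rewrite (cvg_shiftS (series _)).
Qed.

(** The identity theorem, with the zeros in a compact subset of the disc of
    radius rho and possibly away from 0. Rescaling the variable by a radius
    between m and rho makes the coefficients square summable. *)
Lemma pseries_coefs_eq0 (rho C m : R) (d : nat -> R) (x : nat -> R) :
  (forall k, `|d k| * rho ^+ k <= C) -> m < rho ->
  (forall i, x i != 0) -> (forall i, `|x i| <= m) -> injective x ->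
  (forall i, series (fun k => d k * x i ^+ k) @ \oo --> (0 : R)) ->
  forall k, d k = 0.
Proof.
move=> dC mrho x0 xm xinj dx k.
have m0 : 0 < m by rewrite (lt_le_trans _ (xm 0%N)) // normr_gt0.
have rho0 : 0 < rho := lt_trans m0 mrho.
pose sigma := (m + rho) / 2.
have sigma0 : 0 < sigma by rewrite /sigma; lra.
have C0 : 0 <= C.
  by apply: le_trans (dC 0%N); rewrite mulr_ge0 // exprn_ge0 // ltW.
pose r := (sigma / rho) ^+ 2.
have sr0 : 0 <= sigma / rho by rewrite ltW // divr_gt0.
have r1 : 0 < 1 - r.
  rewrite subr_gt0 /r expr_lt1 //.
  by rewrite ltr_pdivrMr // mul1r /sigma; lra.
have r0 : 0 <= r by exact: sqr_ge0.
have sk : sigma ^+ k != 0 by rewrite expf_neq0 // gt_eqF.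
suff dk0 : d k * sigma ^+ k = 0.
  by move/eqP : dk0; rewrite mulf_eq0 (negbTE sk) orbF => /eqP.
apply: (@l2_coefs_eq0 (m / sigma) (C ^+ 2 / (1 - r))
  (fun k => d k * sigma ^+ k) (fun i => x i / sigma)).
- by rewrite ltr_pdivrMr // mul1r /sigma; lra.
- by move=> i; rewrite mulf_neq0 // invr_neq0 // gt_eqF.
- by move=> i; rewrite normrM normfV (gtr0_norm sigma0) ler_pM2r ?invr_gt0.
- by move=> i j /(mulIf _) /xinj; apply; rewrite invr_neq0 // gt_eqF.
- move=> n; apply: (@le_trans _ _ (\sum_(j < n) C ^+ 2 * r ^+ j)).
    apply: ler_sum => j _.
    rewrite -[leLHS]real_normK ?num_real //.
    have -> : C ^+ 2 * r ^+ j = (C * (sigma / rho) ^+ j) ^+ 2.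
      by rewrite /r exprAC -exprMn.
    rewrite lerXn2r ?nnegrE ?mulr_ge0 ?(exprn_ge0 _ sr0) //.
    rewrite normrM (ger0_norm (exprn_ge0 _ (ltW sigma0))).
    rewrite [leRHS](_ : _ = C * (sigma ^+ j / rho ^+ j)); last first.
      by rewrite -expr_div_n.
    rewrite mulrA ler_pdivlMr ?exprn_gt0 // mulrAC.
    by rewrite ler_wpM2r // exprn_ge0 // ltW.
  apply: geometric_sum_le; first exact: sqr_ge0.
  by rewrite r0 -subr_gt0.
- move=> i; have -> : (fun k => d k * sigma ^+ k * (x i / sigma) ^+ k)
    = (fun k => d k * x i ^+ k); last exact: dx.
  apply/funext => j; rewrite -mulrA -exprMn mulrC [sigma * _]mulrC.
  by rewrite divfK ?gt_eqF // mulrC.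
Qed.

End ZerosOfPowerSeries.

(** * Termwise differentiation *)

Section SeriesOfQuaternions.
Context {R : realType}.
Implicit Types (q p e : quat R) (Omega : set (quat R)) (a : nat -> quat R).

Lemma open_qabs Omega q : open Omega -> Omega q ->
  exists2 eps : R, 0 < eps & forall p, qabs (p - q) < eps -> Omega p.
Proof.
move=> Oo Oq; have /nbhs_ballP[eps /= eps0 epsO] := open_nbhs_nbhs (conj Oo Oq).
exists eps => // p pq; apply: epsO; rewrite -ball_normE /= distrC.
exact: le_lt_trans (normr_le_qabs _) pq.
Qed.

Lemma qabs_geometric_cvg (u : nat -> quat R) (K r : R) : 0 <= r < 1 ->
  (forall k, qabs (u k) <= K * r ^+ k) -> cvgn (series u).
Proof.
move=> /andP[r0 r1] uK; apply: normed_cvg.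
have u0 k : 0 <= K * r ^+ k := le_trans (qabs_ge0 _) (uK k).
apply: (@series_le_cvg R _ (geometric K r)) => //= [k|].
  exact: le_trans (normr_le_qabs _) (uK k).
by apply: is_cvg_geometric_series; rewrite ger0_norm.
Qed.

Lemma lim_series_bound (u : nat -> quat R) l (B : R) :
  (forall n, `|series u n| <= B) -> series u @ \oo --> l -> `|l| <= B.
Proof.
move=> uB /cvg_norm ul; rewrite -(cvg_lim _ ul) //; apply: limr_le.
  exact: cvgP ul.
exact: nearW.
Qed.

(** Adding up the first order Taylor remainders of the terms, each at most t^2
    times a geometric term, bounds that of the sum by a multiple of t^2. *)
Lemma is_derive_series (F : quat R -> quat R) q e (phi : nat -> R -> quat R)
    (phi' : nat -> quat R) L (K r delta : R) :
  0 < delta -> 0 <= K -> 0 <= r < 1 ->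
  (forall t, `|t| < delta -> series (phi ^~ t) @ \oo --> F (q + t *: e)) ->
  series phi' @ \oo --> L ->
  (forall t k, `|t| < delta ->
     qabs (phi k t - phi k 0 - t *: phi' k) <= t ^+ 2 * (K * r ^+ k)) ->
  is_derive q e F L.
Proof.
move=> delta0 K0 r01 phiF phiL rem.
pose B := K / (1 - r).
have B0 : 0 <= B by have := geometric_sum_le 0 K0 r01; rewrite big_ord0.
have taylor t : `|t| < delta ->
    `|F (q + t *: e) - F q - t *: L| <= t ^+ 2 * B.
  move=> td.
  pose u k := phi k t - phi k 0 - t *: phi' k.
  apply: (@lim_series_bound u) => [n|].
    rewrite seriesEord /=; apply: le_trans (ler_norm_sum _ _ _) _.
    apply: (@le_trans _ _ (\sum_(k < n) t ^+ 2 * (K * r ^+ k))).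
      by apply: ler_sum => k _; apply: le_trans (normr_le_qabs _) (rem t k td).
    by rewrite -mulr_sumr ler_wpM2l ?sqr_ge0 // geometric_sum_le.
  have -> : series u = (fun n => series (phi ^~ t) n - series (phi ^~ 0) n
      - t *: series phi' n).
    by apply/funext => n; rewrite !seriesEord /= scaler_sumr -!sumrB.
  have F0 : series (phi ^~ 0) @ \oo --> F q.
    by have := phiF 0; rewrite normr0 scale0r addr0; apply.
  by apply: cvgB; [apply: cvgB => //; exact: phiF | exact: cvgZr].
have lim : h^-1 *: ((F \o shift q) (h *: e) - F q) @[h --> 0^'] --> L.
  apply/cvgrPdist_le => eps eps0; near=> h.
  have h0 : h != 0 by near: h; exact: nbhs_dnbhs_neq.
  have hd : `|h| < delta by near: h; exact: dnbhs0_lt.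
  have hB : `|h| < eps / (B + 1).
    by near: h; apply: dnbhs0_lt; rewrite divr_gt0 // ltr_wpDl.
  have -> : L - h^-1 *: ((F \o shift q) (h *: e) - F q)
      = - h^-1 *: (F (q + h *: e) - F q - h *: L).
    rewrite /= [_ *: e + q]addrC scaleNr [_ *: (_ - h *: L)]scalerBr scalerA.
    by rewrite mulVf // scale1r opprB.
  rewrite normrZ normrN normfV ler_pdivrMl ?normr_gt0 //.
  apply: le_trans (taylor h hd) _.
  rewrite -[h ^+ 2]real_normK ?num_real // expr2 -mulrA ler_wpM2l //.
  move: hB; rewrite ltr_pdivlMr ?ltr_wpDl // => hB.
  by apply: le_trans (ltW hB); rewrite ler_wpM2l // lerDl.
apply: DeriveDef; first exact: cvgP lim.
by apply: cvg_lim => //; exact: norm_hausdorff.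
Unshelve. all: by end_near.
Qed.

(** The power series with coefficients a has a radius of convergence larger than
    the modulus of each point of Omega, which leaves room to differentiate
    termwise there. *)
Definition decays_beyond Omega a := forall q, Omega q ->
  exists rho C : R, qabs q < rho /\ forall k, qabs (a k) * rho ^+ k <= C.

Section TermwisePartial.
Variables (Omega : set (quat R)) (a : nat -> quat R) (e : quat R).
Variables (P DP : nat -> quat R -> quat R) (F : quat R -> quat R).
Hypotheses (Oopen : open Omega) (aO : decays_beyond Omega a).
Hypothesis e1 : qabs e = 1.
Hypothesis PF : forall q, Omega q ->
  series (fun k => P k q * a k) @ \oo --> F q.
Hypothesis PT : forall q (eta : R), 0 < eta ->
  exists2 A : R, 0 <= A & forall t k, `|t| <= eta ->
    qabs (P k (q + t *: e) - P k q - t *: DP k q)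
      <= t ^+ 2 * (A * (qabs q + eta *+ 2) ^+ k).
Hypothesis DPb : forall q (eta : R), 0 < eta ->
  exists2 A : R, 0 <= A &
    forall k, qabs (DP k q) <= A * (qabs q + eta *+ 2) ^+ k.

(** Used for the powers and then for their derivatives [dpow], so the family P
    and its derivative DP along e are kept abstract. *)
Lemma termwise_partial q : Omega q ->
  derivable F q e /\ series (fun k => DP k q * a k) @ \oo --> 'D_e F q.
Proof.
move=> Oq; have [rho [C [qrho aC]]] := aO Oq.
have rho0 : 0 < rho := le_lt_trans (qabs_ge0 q) qrho.
have C0 : 0 <= C.
  by apply: le_trans (aC 0%N); rewrite mulr_ge0 ?qabs_ge0 // exprn_ge0 // ltW.
have [eps eps0 epsO] := open_qabs Oopen Oq.
pose eta := (rho - qabs q) / 3.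
have eta0 : 0 < eta by rewrite /eta; lra.
pose s := qabs q + eta *+ 2.
have s0 : 0 <= s by rewrite addr_ge0 ?qabs_ge0 // mulrn_wge0 // ltW.
have srho : s < rho by rewrite /s /eta mulr2n; lra.
have r01 : 0 <= s / rho < 1.
  by rewrite divr_ge0 ?(ltW rho0) //= ltr_pdivrMr // mul1r.
have [A A0 AT] := PT q eta0.
have [A' A'0 AD] := DPb q eta0.
have decay k (x X : R) : 0 <= x -> x <= X * s ^+ k ->
    x * qabs (a k) <= X * C * (s / rho) ^+ k.
  move=> x0 xX; have rk : 0 < rho ^+ k by rewrite exprn_gt0.
  rewrite expr_div_n [leRHS](_ : _ = X * s ^+ k * (C / rho ^+ k)); last by ring.
  by rewrite ler_pM ?qabs_ge0 // ler_pdivlMr.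
have cvgD : cvgn (series (fun k => DP k q * a k)).
  apply: (qabs_geometric_cvg r01) => k; rewrite qabsM.
  by apply: decay; rewrite ?qabs_ge0.
pose delta := Num.min eta eps.
have : is_derive q e F (limn (series (fun k => DP k q * a k))).
  apply: (@is_derive_series F q e (fun k t => P k (q + t *: e) * a k)
    (fun k => DP k q * a k) _ (A * C) (s / rho) delta) => //.
  - by rewrite lt_min eta0.
  - exact: mulr_ge0.
  - move=> t; rewrite lt_min => /andP[_ teps]; apply: PF; apply: epsO.
    by rewrite addrC addKr qabsZ e1 mulr1.
  - move=> t k; rewrite lt_min => /andP[/ltW teta _].
    rewrite scale0r addr0 -scaleqAl -!mulrBl qabsM.
    by rewrite !mulrA decay ?qabs_ge0 // -mulrA AT.
case=> Fd dF; split; first exact: Fd.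
by rewrite dF; exact: cvgD.
Qed.

End TermwisePartial.
End SeriesOfQuaternions.

(** * Pointwise convergence forces geometric decay *)

Section Decay.
Context {R : realType}.
Implicit Types (q p : quat R) (Omega : set (quat R)) (a : nat -> quat R).

Lemma eventually_bounded (x : nat -> R) N C :
  (forall k, (N <= k)%N -> x k <= C) -> exists C', forall k, x k <= C'.
Proof.
move=> xC; exists (`|C| + \sum_(j < N) `|x j|) => k.
have [kN|/xC xkC] := ltnP k N.
  rewrite (bigD1 (Ordinal kN)) //= addrCA (le_trans (ler_norm _)) // lerDl.
  by rewrite addr_ge0 // sumr_ge0.
by rewrite (le_trans xkC) // (le_trans (ler_norm _)) // lerDl sumr_ge0.
Qed.

Lemma terms_bounded (u : nat -> quat R) :
  cvgn (series u) -> exists C, forall k, qabs (u k) <= C.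
Proof.
move=> /cvg_series_cvg_0 /cvgP /cvg_seq_bounded[M [_ uM]].
exists (2 * (M + 1)) => k; apply: le_trans (qabs_le_normr _) _.
by rewrite ler_pM2l //; apply: (uM (M + 1)); rewrite // ltrDl.
Qed.

(** Moving q along i, away from 0, increases the modulus and makes it nonreal. *)
Lemma farther_nonreal_point Omega q : open Omega -> Omega q ->
  exists p, [/\ Omega p, qabs q < qabs p & im1 p != 0].
Proof.
move=> Oo Oq; have [eps eps0 epsO] := open_qabs Oo Oq.
pose t := if 0 <= im1 q then eps / 2 else - (eps / 2).
have [t0 tq tn] : [/\ `|t| < eps, 0 <= im1 q * t & t != 0].
  have e2 : 0 < eps / 2 by rewrite divr_gt0.
  rewrite /t; case: (leP 0 (im1 q)) => q0.
    split; [by rewrite gtr0_norm //; lra | by rewrite mulr_ge0 // ltW |].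
    by rewrite gt_eqF.
  split; [by rewrite normrN gtr0_norm //; lra | by nra |].
  by rewrite oppr_eq0 gt_eqF.
have t2 : 0 < t ^+ 2 by rewrite exprn_even_gt0.
exists (q + mkq 0 t 0 0); split.
- apply: epsO; rewrite addrC addKr (_ : qabs _ = `|t|) //.
  by apply: qabsP => //; rewrite real_normK ?num_real // !quatE; ring.
- rewrite -ltr_sqr ?nnegrE ?qabs_ge0 // !sqr_qabs !quatE; nra.
- rewrite !quatE -sqrf_eq0 gt_eqF //; have := sqr_ge0 (im1 q); nra.
Qed.

(** Convergence at a point of larger modulus bounds the terms there. *)
Lemma pow_decays Omega a : open Omega ->
  (forall q, Omega q -> cvgn (series (fun k => q ^+ k * a k))) ->
  decays_beyond Omega a.
Proof.
move=> Oo cv q Oq; have [p [Op qp _]] := farther_nonreal_point Oo Oq.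
have [C aC] := terms_bounded (cv p Op).
exists (qabs p), C; split=> // k.
by have := aC k; rewrite qabsM qabsX mulrC.
Qed.

(** The coefficients of the Laplacian of a power series in the basis [Qpoly]. *)
Definition tau_coef a k : quat R :=
  - (2 * (k + 1)%N%:R * (k + 2)%N%:R) *: a k.+2.

Lemma Qpoly_tau_coef a k q :
  Qpoly k q * tau_coef a k = - (4 : R) *: (qsum k q * a k.+2).
Proof.
rewrite Qpoly_qsum /tau_coef scaleqAr scaleqAl scalerA; congr (_ *: _).
have k1 : (k + 1)%N%:R != 0 :> R by rewrite pnatr_eq0 addn1.
have k2 : (k + 2)%N%:R != 0 :> R by rewrite pnatr_eq0 addn2.
move: k1 k2; move: (k + 1)%N%:R (k + 2)%N%:R => x y x0 y0.
by field; rewrite ?x0 ?y0.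
Qed.

Lemma qsum_lower_bound k q :
  (k + 2)%N%:R * qabs (q - qconj q) * qabs q ^+ k.+1 - 2 * qabs q ^+ k.+2
  <= qabs (q - qconj q) ^+ 2 * qabs (qsum k q).
Proof.
rewrite -[_ ^+ 2]qabsX -qabsM qsum_telescope -addrA.
apply: le_trans (ler_qabsB _ _).
rewrite qabsZ qabsM qabsX ger0_norm // [_ ^+ k.+1 * _]mulrC.
rewrite [_ * (_ * qabs q ^+ _)]mulrA lerD2l lerN2.
apply: le_trans (ler_qabsD _ _) _.
by rewrite qabsN !qabsX qabs_conj; lra.
Qed.

(** By [qsum_lower_bound] at a nonreal point p of larger modulus, the k-th
    term of the Q-series eventually dominates, up to a constant, p^(k+2)
    a_(k+2). *)
Lemma Qpoly_decays Omega a : open Omega ->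
  (forall q, Omega q -> cvgn (series (fun k => Qpoly k q * tau_coef a k))) ->
  decays_beyond Omega a.
Proof.
move=> Oo cv q Oq; have [p [Op qp p1]] := farther_nonreal_point Oo Oq.
have [C aC] := terms_bounded (cv p Op).
set r := qabs p in qp *; exists r.
have r0 : 0 < r := le_lt_trans (qabs_ge0 q) qp.
pose d := qabs (p - qconj p).
have d0 : 0 < d.
  rewrite lt0r qabs_ge0 andbT -sqrf_eq0 sqr_qabs gt_eqF // !quatE.
  have : 0 < im1 p ^+ 2 by rewrite exprn_even_gt0.
  nra.
suff [C' aC'] : exists C', forall k, qabs (a k) * r ^+ k <= C' by exists C'.
(* From the index N on, (k + 2) d >= 3 r, so that the leading term of the lower
   bound exceeds the subtracted one by at least r^(k+2). *)
pose N := Num.bound (3 * r / d).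
apply: (@eventually_bounded _ N.+2 (d ^+ 2 * C)) => -[|[|k]] // Nk.
have kN : 3 * r <= (k + 2)%N%:R * d.
  rewrite -ler_pdivrMr //; apply: le_trans (ltW (archi_boundP _)) _.
    by rewrite divr_ge0 ?mulr_ge0 // ltW.
  have Nk0 : (N <= k)%N by [].
  by rewrite ler_nat; exact: (leq_trans Nk0 (leq_addr 2 k)).
have := aC k; rewrite Qpoly_tau_coef qabsZ qabsM normrN ger0_norm // => aCk.
have := qsum_lower_bound k p; rewrite -/r -/d => lb.
have rk : 0 <= r ^+ k.+1 by rewrite exprn_ge0 // ltW.
have a0 := qabs_ge0 (a k.+2); have S0 := qabs_ge0 (qsum k p).
have h1 : r ^+ k.+2 <= d ^+ 2 * qabs (qsum k p).
  apply: le_trans lb; rewrite [r ^+ k.+2]exprS.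
  have : 3 * r * r ^+ k.+1 <= (k + 2)%N%:R * d * r ^+ k.+1 by rewrite ler_wpM2r.
  lra.
have h2 : r ^+ k.+2 * qabs (a k.+2) <= d ^+ 2 * qabs (qsum k p) * qabs (a k.+2).
  by rewrite ler_wpM2r.
rewrite mulrC; apply: le_trans h2 _; rewrite -mulrA ler_wpM2l ?sqr_ge0 //.
have := mulr_ge0 S0 a0; lra.
Qed.

Lemma decays_cvg Omega a q : decays_beyond Omega a -> Omega q ->
  cvgn (series (fun k => q ^+ k * a k)).
Proof.
move=> aO Oq; have [rho [C [qrho aC]]] := aO q Oq.
have rho0 : 0 < rho := le_lt_trans (qabs_ge0 q) qrho.
apply: (@qabs_geometric_cvg _ _ C (qabs q / rho)) => [|k].
  by rewrite divr_ge0 ?qabs_ge0 ?(ltW rho0) //= ltr_pdivrMr // mul1r.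
rewrite qabsM qabsX expr_div_n mulrA ler_pdivlMr ?exprn_gt0 //.
by rewrite -mulrA mulrC ler_wpM2r // exprn_ge0 // qabs_ge0.
Qed.

End Decay.

(** * The Laplacian of a power series *)

Section LaplacianOfSeries.
Context {R : realType}.
Variables (Omega : set (quat R)) (a : nat -> quat R) (f : Omega -> quat R).
Hypotheses (Oopen : open Omega) (aO : decays_beyond Omega a).
Hypothesis af : forall q : Omega,
  series (fun k => val q ^+ k * a k) @ \oo --> f q.

Lemma ext0E (q : Omega) : ext0 f (val q) = f q.
Proof. exact: (congr1 (@^~ q) (valLK 0 f)). Qed.

Let pF q : Omega q -> series (fun k => q ^+ k * a k) @ \oo --> ext0 f q.
Proof.
move=> Oq; pose q' : Omega := exist _ q (mem_set Oq).
by have := @af q'; rewrite -ext0E.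
Qed.

Let first_partial (i : 'I_4) q : Omega q ->
  has_partial i (ext0 f) q /\
  series (fun k => dpow (qunit i) k q * a k) @ \oo --> partial i (ext0 f) q.
Proof.
apply: (termwise_partial Oopen aO (qabs_delta i) pF) => {}q eta eta0.
  exists (eta ^- 2) => [|t k te]; first by rewrite invr_ge0 sqr_ge0.
  by rewrite mulrA pow_taylor ?qabs_delta.
exists eta^-1 => [|k]; first by rewrite invr_ge0 ltW.
by apply: dpow_bound; rewrite ?qabs_delta // lerDl ltW.
Qed.

Let second_partial (i : 'I_4) q : Omega q ->
  has_partial i (partial i (ext0 f)) q /\
  series (fun k => ddpow (qunit i) k q * a k) @ \oo
    --> partial i (partial i (ext0 f)) q.
Proof.
apply: (termwise_partial Oopen aO (qabs_delta i)
  (fun q Oq => (first_partial i Oq).2)) => {}q eta eta0.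
  exists (3 * eta ^- 3) => [|t k te].
    by rewrite mulr_ge0 // invr_ge0 exprn_ge0 // ltW.
  by rewrite mulrA [t ^+ 2 * _]mulrA [t ^+ 2 * 3]mulrC dpow_taylor ?qabs_delta.
exists (2 * eta ^- 2) => [|k]; first by rewrite mulr_ge0 // invr_ge0 sqr_ge0.
by rewrite ddpow_bound ?qabs_delta.
Qed.

Lemma has_laplacian_series : has_laplacian f.
Proof.
move=> q i; have Oq : Omega (val q) := set_mem (valP q).
by split; [exact: (first_partial i Oq).1 | exact: (second_partial i Oq).1].
Qed.

(** The powers of exponent 0 and 1 are harmonic, whence the shift by two of the
    indices. *)
Lemma tau_series (q : Omega) :
  series (fun k => Qpoly k (val q) * tau_coef a k) @ \oo --> tau f q.
Proof.
have Oq : Omega (val q) := set_mem (valP q).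
rewrite /tau big_ord4.
pose S i := series (fun k => ddpow (qunit i) k (val q) * a k).
have lim : S (inord 0) n + S (inord 1) n + S (inord 2) n + S (inord 3) n
    @[n --> \oo] --> partial (inord 0) (partial (inord 0) (ext0 f)) (val q)
     + partial (inord 1) (partial (inord 1) (ext0 f)) (val q)
     + partial (inord 2) (partial (inord 2) (ext0 f)) (val q)
     + partial (inord 3) (partial (inord 3) (ext0 f)) (val q).
  apply: cvgD; last exact: (second_partial _ Oq).2.
  apply: cvgD; last exact: (second_partial _ Oq).2.
  by apply: cvgD; exact: (second_partial _ Oq).2.
move: lim; rewrite -cvg_shiftS -cvg_shiftS.
set u := (X in X @ _ --> _ -> _); set v := series _.
suff -> : u = v by [].
apply/funext => n; rewrite /u /=; have /= <- := big_ord4 (fun i => S i n.+2).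
rewrite /S /v [in RHS]seriesEord /=.
under eq_bigr do rewrite seriesEord /=.
rewrite exchange_big (big_ord_recl n.+1) (big_ord_recl n) /=.
rewrite big1 => [|i _]; last by rewrite mul0r.
rewrite big1 => [|i _]; last by rewrite !(mulr0, mul0rn, add0r, mul0r).
rewrite !add0r; apply: eq_bigr => k _; rewrite -mulr_suml.
rewrite [X in X * _](laplacian_pow k (val q)) /bump /= !add1n.
by rewrite Qpoly_tau_coef scaleqAl.
Qed.

End LaplacianOfSeries.

(** * Uniqueness of the coefficients of a Q-series *)

Section Uniqueness.
Context {R : realType}.
Implicit Types (q : quat R) (Omega : set (quat R)).

Lemma Qpoly_real k (x : R) : Qpoly k (qreal x) = qreal (x ^+ k).
Proof.
have xX j : qreal x ^+ j = qreal (x ^+ j).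
  elim: j => [|j IH] //.
  by rewrite !exprS IH; apply: quatP; rewrite !quatE; ring.
have xc : qconj (qreal x) = qreal x.
  by apply: quatP; rewrite !quatE ?oppr0.
have qsumx : qsum k (qreal x)
    = (\sum_(j < k.+1) (k - j + 1)%N%:R) *: qreal (x ^+ k).
  rewrite /qsum scaler_suml; apply: eq_bigr => j _.
  by rewrite xc -exprD (subnK (leq_ord j)) xX.
have tri m : (\sum_(j < m.+1) (m - j + 1)%N%:R) *+ 2
    = (m + 1)%N%:R * (m + 2)%N%:R :> R.
  elim: m => [|m IH]; first by rewrite big_ord1 /= add0n mul1r.
  rewrite big_ord_recl mulrnDl subn0.
  under eq_bigr => j _ do rewrite /= /bump /= add1n subSS.
  rewrite IH !addSn !addn1 !addn2 -!natr1; ring.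
rewrite Qpoly_qsum qsumx scalerA [_ * \sum_(j < _) _](_ : _ = 1) ?scale1r //.
have := tri k; set T := \sum_(j < _) _ => T2.
have -> : 2 / ((k + 1)%N%:R * (k + 2)%N%:R) * T = 
  (T *+ 2) / ((k + 1)%N%:R * (k + 2)%N%:R) by ring.
by rewrite T2 divff // mulf_neq0 // pnatr_eq0 ?addn1 ?addn2.
Qed.

Lemma coord_cvg0 (u : nat -> quat R) j :
  u @ \oo --> (0 : quat R) -> u n ord0 j @[n --> \oo] --> (0 : R).
Proof.
move=> /cvgr0Pnorm_lt u0; apply/cvgr0Pnorm_lt => e e0.
have := u0 (e / 2) (divr_gt0 e0 _); rewrite ltr0n => /(_ isT).
apply: filterS => n un; apply: le_lt_trans (coord_le_qabs _ _) _.
apply: le_lt_trans (qabs_le_normr _) _.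
by rewrite mulrC -ltr_pdivlMr.
Qed.

(** On the real axis the Q-series is an ordinary power series, to whose
    components [pseries_coefs_eq0] applies. As the origin may lie outside
    Omega, these zeros need not accumulate at 0. *)
Lemma Qpoly_coefs_eq0 Omega (d : nat -> quat R) :
  open Omega -> Omega `&` range qreal !=set0 ->
  (forall q, Omega q ->
     series (fun k => Qpoly k q * d k) @ \oo --> (0 : quat R)) ->
  d = fun=> 0.
Proof.
move=> Oo [z [Oz [x0 _ x0z]]] dO.
have Ox0 : Omega (qreal x0) by rewrite x0z.
have realB (x y : R) : qabs (qreal x - qreal y) = `|x - y|.
  by rewrite -qabs_real; congr qabs; apply: quatP; rewrite !quatE; ring.
have [x1 [x1N0 Ox1]] : exists x1, x1 != 0 /\ Omega (qreal x1).
  have [x00|x0N0] := eqVneq x0 0; last by exists x0.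
  have [eps eps0 epsO] := open_qabs Oo Ox0.
  exists (eps / 2); split; first by rewrite gt_eqF // divr_gt0.
  by apply: epsO; rewrite realB x00 subr0 gtr0_norm ?divr_gt0 //; lra.
have [eps eps0 epsO] := open_qabs Oo Ox1.
have x1p : 0 < `|x1| by rewrite normr_gt0.
pose eta := Num.min (1 / 2) (eps / (2 * `|x1|)).
have eta0 : 0 < eta.
  by rewrite lt_min divr_gt0 //= divr_gt0 // mulr_gt0.
have eta1 : eta <= 1 / 2 by rewrite ge_min lexx.
have etae : eta * `|x1| < eps.
  have : eta <= eps / (2 * `|x1|) by rewrite ge_min lexx orbT.
  rewrite ler_pdivlMr ?mulr_gt0 // mulrCA => h.
  have : 0 < eta * `|x1| by rewrite mulr_gt0.
  lra.
(* Infinitely many points of Omega on the real axis between x1 (1 - eta) and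
   x1 (1 - eta / 2), away from 0. *)
pose w i : R := 1 - eta + eta / 2 / i.+1%:R.
have wi i : 1 - eta <= w i <= 1 - eta / 2.
  have i0 : 0 < i.+1%:R :> R by rewrite ltr0n.
  have h : eta / 2 / i.+1%:R <= eta / 2.
    by rewrite ler_pdivrMr // ler_peMr ?ler1n // ltW // divr_gt0.
  have h' : 0 <= eta / 2 / i.+1%:R by rewrite !divr_ge0 // ltW.
  move: h h'; rewrite /w; move: (_ / _ / _) => T h h'.
  by apply/andP; split; lra.
have w_inj : injective w.
  move=> i j /addrI /(mulfI _) h; apply: succn_inj.
  apply/eqP; rewrite -(eqr_nat R); apply/eqP/invr_inj/h.
  by rewrite gt_eqF // divr_gt0.
have Ow i : Omega (qreal (x1 * w i)).
  apply: epsO; rewrite realB -[X in _ - X]mulr1 -mulrBr normrM mulrC.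
  apply: le_lt_trans etae; rewrite ler_wpM2r //.
  by have /andP[h1 h2] := wi i; rewrite ler0_norm; lra.
have [C dC] := terms_bounded (cvgP _ (dO _ Ox1)).
apply/funext => k; apply/rowP => j; rewrite mxE.
move: k; apply: (@pseries_coefs_eq0 R `|x1| C (`|x1| * (1 - eta / 2)) _
  (fun i => x1 * w i)).
- move=> k; apply: le_trans (dC k).
  rewrite Qpoly_real qabsM qabs_real normrX mulrC ler_wpM2l ?exprn_ge0 //.
  exact: coord_le_qabs.
- by rewrite gtr_pMr // gtrBl divr_gt0.
- by move=> i; rewrite mulf_neq0 // gt_eqF //; have /andP[h _] := wi i; lra.
- move=> i; rewrite normrM ler_wpM2l //; have /andP[h h'] := wi i.
  by rewrite ger0_norm //; lra.
- by move=> i i' /(mulfI x1N0) /w_inj.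
- move=> i; have := coord_cvg0 j (dO _ (Ow i)).
  set u := fun k => Qpoly k _ * d k; have -> : (fun n => series u n ord0 j)
    = series (fun k => d k ord0 j * (x1 * w i) ^+ k); last by [].
  apply/funext => n; rewrite !seriesEord /= summxE /u.
  apply: eq_bigr => k _; rewrite Qpoly_real.
  have -> : qreal ((x1 * w i) ^+ k) * d k = (x1 * w i) ^+ k *: d k.
    by apply: quatP; rewrite !quatE; ring.
  by rewrite mxE [RHS]mulrC.
Qed.

End Uniqueness.

(** * Weighted norms and the image of the Fueter mapping *)

Section WeightedNorms.
Context {R : realType}.
Implicit Types (c : nat -> R) (a : nat -> quat R).

Definition tau_weight c k : R :=
  c (k + 2)%N / ((k + 1)%N%:R ^+ 2 * (k + 2)%N%:R ^+ 2).

Lemma tau_weight_term c a k :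
  tau_weight c k * qabs (tau_coef a k) ^+ 2 = 4 * (c k.+2 * qabs (a k.+2) ^+ 2).
Proof.
rewrite /tau_weight /tau_coef qabsZ exprMn real_normK ?num_real // addn2.
have k1 : (k + 1)%N%:R != 0 :> R by rewrite pnatr_eq0 addn1.
have k2 : (k.+2)%:R != 0 :> R by rewrite pnatr_eq0.
move: k1 k2; move: (k + 1)%N%:R k.+2%:R => x y x0 y0.
by field; rewrite ?x0 ?y0.
Qed.

Lemma series_tau_weight c a n :
  series (fun k => tau_weight c k * qabs (tau_coef a k) ^+ 2) n
  = 4 * (series (fun k => c k * qabs (a k) ^+ 2) n.+2
         - c 0%N * qabs (a 0%N) ^+ 2 - c 1%N * qabs (a 1%N) ^+ 2).
Proof.
rewrite !seriesEord /= (big_ord_recl n.+1) (big_ord_recl n) /=.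
under [LHS]eq_bigr do rewrite tau_weight_term.
rewrite -mulr_sumr; congr (_ * _).
under [in RHS]eq_bigr do rewrite /bump /= !add1n.
by rewrite /bump /= addn0; ring.
Qed.

Lemma cvg_tau_weight c a :
  cvgn (series (fun k => tau_weight c k * qabs (tau_coef a k) ^+ 2)) ->
  cvgn (series (fun k => c k * qabs (a k) ^+ 2)).
Proof.
move=> cvT; set S := series _.
have -> : cvgn S = cvgn (fun n => S n.+2).
  apply/propext; split=> /cvg_ex[l]; first by rewrite -2!cvg_shiftS => /cvgP.
  by rewrite (cvg_shiftS (fun n => S n.+1)) (cvg_shiftS S) => /cvgP.
pose w k := c k * qabs (a k) ^+ 2.
have -> : (fun n => S n.+2) = (fun n => 4^-1 *
    series (fun k => tau_weight c k * qabs (tau_coef a k) ^+ 2) n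
    + (w 0%N + w 1%N)).
  by apply/funext => n; rewrite series_tau_weight /S /w; field.
apply: is_cvgD; last exact: is_cvg_cst.
exact: is_cvgMr.
Qed.

Lemma lim_tau_weight c a l :
  series (fun k => c k * qabs (a k) ^+ 2) @ \oo --> l ->
  series (fun k => tau_weight c k * qabs (tau_coef a k) ^+ 2) @ \oo -->
    4 * (l - c 0%N * qabs (a 0%N) ^+ 2 - c 1%N * qabs (a 1%N) ^+ 2).
Proof.
move=> Sl; have -> : series (fun k => tau_weight c k * qabs (tau_coef a k) ^+ 2)
  = (fun n => 4 * (series (fun k => c k * qabs (a k) ^+ 2) n.+2
         - c 0%N * qabs (a 0%N) ^+ 2 - c 1%N * qabs (a 1%N) ^+ 2)).
  by apply/funext => n; rewrite series_tau_weight.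
apply: cvgMr; apply: cvgB; last exact: cvg_cst.
apply: cvgB; last exact: cvg_cst.
by rewrite (cvg_shiftS (fun n => series _ n.+1)) (cvg_shiftS (series _)).
Qed.

End WeightedNorms.

Section FueterImage.
Context {R : realType}.
Variables (Omega : set (quat R)) (c : nat -> R).
Hypotheses (Oopen : open Omega) (Oreal : Omega `&` range qreal !=set0).
Hypotheses (c_ge0 : forall k, 0 <= c k) (c0 : c 0%N = 1).

Lemma HM_coefsP b (g : Omega -> quat R) (al : nat -> quat R) :
  series_coefs Qpoly b g al -> HM_coef b g = al.
Proof.
move=> gal; apply: xget_unique => // be gbe.
suff sub0 : (fun k => be k - al k) = fun=> 0.
  apply/funext => k; apply/eqP; rewrite -subr_eq0; apply/eqP.
  exact: (congr1 (@^~ k) sub0).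
apply: (Qpoly_coefs_eq0 Oopen Oreal) => q Oq.
pose q' : Omega := exist _ q (mem_set Oq).
rewrite -(subrr (g q')).
have -> : series (fun k => Qpoly k q * (be k - al k))
  = (fun n => series (fun k => Qpoly k q * be k) n
              - series (fun k => Qpoly k q * al k) n).
  apply/funext => n; rewrite !seriesEord /= -sumrB.
  by apply: eq_bigr => i _; rewrite mulrBr.
by apply: cvgB; [exact: (gbe.1 q') | exact: (gal.1 q')].
Qed.

Lemma series_coefs_decays (f : Omega -> quat R) a :
  series_coefs pow_basis c f a -> decays_beyond Omega a.
Proof.
move=> [af _]; apply: pow_decays => // q Oq.
exact: cvgP (af (exist _ q (mem_set Oq))).
Qed.

Lemma tau_coefs (f : Omega -> quat R) a : series_coefs pow_basis c f a ->
  series_coefs Qpoly (tau_weight c) (tau f) (tau_coef a).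
Proof.
move=> fa; have aO := series_coefs_decays fa; case: fa => af ac.
split=> [q|]; first exact: (tau_series Oopen aO af).
exact: cvgP (lim_tau_weight ac).
Qed.

(** The constant and linear coefficients, which the Laplacian kills, are
    chosen to be 0. *)
Definition tau_lift (al : nat -> quat R) k : quat R :=
  if k is j.+2 then - (2 * (j + 1)%N%:R * (j + 2)%N%:R)^-1 *: al j else 0.

Lemma tau_liftK al : tau_coef (tau_lift al) = al.
Proof.
by apply/funext => k; rewrite /tau_coef /= scalerA mulrNN divff ?scale1r.
Qed.

Lemma tau_HS : @tau R Omega @` HS c = HM (tau_weight c).
Proof.
apply/seteqP; split=> [_ [f [a fa] <-]|g [al [gal alc]]].
  by exists (tau_coef a); exact: tau_coefs.
pose a := tau_lift al; have aal : tau_coef a = al := tau_liftK al.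
have aO : decays_beyond Omega a.
  apply: Qpoly_decays => // q Oq; rewrite aal.
  exact: cvgP (gal (exist _ q (mem_set Oq))).
pose f (q : Omega) := limn (series (fun k => val q ^+ k * a k)).
have fa : series_coefs pow_basis c f a.
  split=> [q|]; first exact: (decays_cvg aO (set_mem (valP q))).
  by apply: cvg_tau_weight; rewrite aal.
exists f; first by exists a.
apply/funext => q; have [tf _] := tau_coefs fa.
rewrite aal in tf.
by rewrite -(cvg_lim (@norm_hausdorff _ _) (tf q))
  (cvg_lim (@norm_hausdorff _ _) (gal q)).
Qed.

Lemma HMnorm_tau (f : Omega -> quat R) : HS c f -> 
  HMnorm (tau_weight c) (tau f) =
  2 * Num.sqrt (HSnorm c f ^+ 2 - qabs (HS_coef c f 0) ^+ 2
                - c 1%N * qabs (HS_coef c f 1) ^+ 2).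
Proof.
move=> fHS.
have fa : series_coefs pow_basis c f (HS_coef c f) by exact: xgetPex.
rewrite /HSnorm; move: (HS_coef c f) fa => a fa.
rewrite /HMnorm (HM_coefsP (tau_coefs fa)) /wnorm.
case: fa => _ ac; rewrite (cvg_lim _ (lim_tau_weight ac)) // c0 mul1r.
have l0 : 0 <= limn (series (fun k => c k * qabs (a k) ^+ 2)).
  apply: limr_ge => //; apply: nearW => n.
  by rewrite seriesEord /= sumr_ge0 // => k _; rewrite mulr_ge0 ?sqr_ge0.
rewrite (sqr_sqrtr l0) sqrtrM // (_ : 4 = 2 ^+ 2); last by ring.
by rewrite sqrtr_sqr ger0_norm.
Qed.

End FueterImage.

Theorem theorem6p1 (R : realType) (Omega : set (quat R)) (c : nat -> R)
    (Omega_slice : slice_domain Omega) (Omega_sym : axially_symmetric Omega)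
    (c_nondecr : {homo c : m n / (m <= n)%N >-> m <= n}) (c0 : c 0%N = 1) :
  exists b : nat -> R,
    [/\ (forall f : Omega -> quat R, HS c f -> has_laplacian f),
        @tau R Omega @` HS c = HM b,
        (forall k : nat,
           b k = c (k + 2)%N / ((k + 1)%N%:R ^+ 2 * (k + 2)%N%:R ^+ 2))
      & (forall f : Omega -> quat R, HS c f ->
           HMnorm b (tau f) =
           2 * Num.sqrt (HSnorm c f ^+ 2 - qabs (HS_coef c f 0) ^+ 2
                         - c 1%N * qabs (HS_coef c f 1) ^+ 2))].
Proof.
case: Omega_slice => Oopen _ Oreal _.
have c_ge0 k : 0 <= c k by rewrite (le_trans ler01) // -c0 c_nondecr.
exists (tau_weight c); split=> //.
- move=> f [a fa]; case: (fa) => af _.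
  exact: (has_laplacian_series Oopen (series_coefs_decays Oopen fa) af).
- exact: tau_HS.
- by move=> f; exact: HMnorm_tau.
Qed.
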